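(* Let $A_1,\dots,A_N$ be real $2\times 2$ matrices with $A_j=P_jJ_jP_j^{-1}$, $P_j$ real invertible, where $A_1$ is Hurwitz stable and $A_2,\dots,A_N$ are unstable, with $P_1,\dots,P_N$ chosen so that each $P_j^{-1}P_1=\begin{pmatrix}a_j&b_j\\c_j&d_j\end{pmatrix}$, $j=2,\dots,N$, has determinant $1$ or $-1$. Let $J_1=\begin{pmatrix}-\alpha_1&\beta_1\\-\beta_1&-\alpha_1\end{pmatrix}$ with $\alpha_1>0$, $\beta_1\ne0$. Let $k,\ell\ge0$ be integers with $k+\ell+1\le N$ and assume: for $2\le j\le k+1$, $J_j=\begin{pmatrix}\alpha_j&\beta_j\\-\beta_j&\alpha_j\end{pmatrix}$ with $\alpha_j\ge0$, $\beta_j\ne0$; for $k+1<j\le k+\ell+1$, $J_j=\begin{pmatrix}n_j&1\\0&n_j\end{pmatrix}$ with $n_j\ge0$; for $k+\ell+1<j\le N$, $J_j=\mathrm{diag}(p_j,q_j)$ with $p_j\le q_j$, $(p_j,q_j)\ne(0,0)$. For $\eta>0$ define: (a) for $2\le j\le k+1$, $$\tau_{1,2}^{(j)}(\eta)=\frac{\alpha_j}{\alpha_1}\eta+\frac1{\alpha_1}\cosh^{-1}\left(\frac{a_j^2+b_j^2+c_j^2+d_j^2}{2}\right);$$ (b) for $k+1<j\le k+\ell+1$, $$\tau_{1,2}^{(j)}(\eta)=\frac{n_j}{\alpha_1}\eta+\frac1{\alpha_1}\sinh^{-1}\left(\left(\frac{c_j^2+d_j^2}{2}\right)\eta\right);$$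 (c) for $k+\ell+1<j\le N$, $$\tau_{1,2}^{(j)}(\eta)=\left(\frac{q_j+p_j}{2\alpha_1}\right)\eta+\frac1{\alpha_1}\sinh^{-1}\left(\sqrt{(a_j^2+b_j^2)(c_j^2+d_j^2)}\,\sinh\left(\frac{q_j-p_j}{2}\,\eta\right)\right).$$ Let $\tau(\eta)=\max_{2\le j\le N}\tau_{1,2}^{(j)}(\eta)$. Then the switched system $\dot x(t)=A_{\sigma(t)}x(t)$ is stable for all $\sigma\in\mathcal S_N[\tau(\eta),\eta]$ and asymptotically stable for all $\sigma\in\mathcal S_N'[\tau(\eta),\eta]$.
   Context: Hurwitz stable: all eigenvalues have negative real part; unstable: at least one eigenvalue has positive real part. The system is $\dot x(t)=A_{\sigma(t)}x(t)$, $x(t)\in\mathbb R^2$ continuous in $t\ge0$. A switching signal $\sigma:[0,\infty)\to\{1,\dots,N\}$ is right-continuous and piecewise constant with infinitely many discontinuities $0<d_1<d_2<\cdots$, $d_k\to\infty$, $d_0=0$; it is governed by the undirected star graph with internal node $A_1$ and leaves $A_2,\dots,A_N$, i.e. with $\sigma(0)=1$ one has $\sigma(d_{2k})=1$ for all $k\ge0$ and $\sigma(d_{2k-1})\in\{2,\dots,N\}$ for all $k\ge1$. Put $t_k=d_{2k-1}-d_{2k-2}$ (time spent in $A_1$) and $s_k=d_{2k}-d_{2k-1}$ (time spent in another subsystem), $k\ge1$. $\mathcal S_N[\tau,\eta]$ is the set of such signals with $\sigma(0)=1$, $t_k\ge\tau$, $s_k\le\eta$ for all $k\in\mathbb N$;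 $\mathcal S_N'[\tau,\eta]$ is the set of $\sigma\in\mathcal S_N[\tau,\eta]$ for which $(t_k,s_k)_{k\ge1}$ does not converge to $(\tau,\eta)$. For a given signal, the system is stable if for every $\varepsilon'>0$ there is $\delta>0$ such that $\|x(0)\|<\delta$ implies $\|x(t)\|<\varepsilon'$ for all $t>0$; it is asymptotically stable if it is stable and $\|x(t)\|\to0$ as $t\to\infty$ for every $x(0)\in\mathbb R^2$. Norms are Euclidean; $\cosh^{-1}:[1,\infty)\to[0,\infty)$. *)

(* Defs.v *)
From HB Require Import structures.
From mathcomp Require Import all_boot all_order all_algebra.
From mathcomp Require Import complex.
From mathcomp Require Import all_classical all_reals all_analysis.

Set Implicit Arguments.
Unset Strict Implicit.
Unset Printing Implicit Defensive.

Import Order.TTheory GRing.Theory Num.Theory.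
Import numFieldNormedType.Exports.

Local Open Scope classical_set_scope.
Local Open Scope ring_scope.

Definition cosh {R : realType} (x : R) : R := (expR x + expR (- x)) / 2.
Definition sinh {R : realType} (x : R) : R := (expR x - expR (- x)) / 2.

(* Inverses of cosh : [0, +oo[ -> [1, +oo[ and of the bijection sinh of R;
   the default 0 is only taken by arcosh, outside [1, +oo[. *)
Definition arcosh {R : realType} : R -> R :=
  'pinv_(fun=> 0) [set x : R | 0 <= x] cosh.
Definition arsinh {R : realType} : R -> R :=
  'pinv_(fun=> 0) [set: R] sinh.

Definition mx22 {R : realType} (a b c d : R) : 'M[R]_2 :=
  \matrix_(i, j) if i == 0 then (if j == 0 then a else b)
                 else (if j == 0 then c else d).

Definition eucl_norm {R : realType} (v : 'cV[R]_2) : R :=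
  Num.sqrt (\sum_i v i 0 ^+ 2).

Definition complex_eigenvalue {R : realType} (A : 'M[R]_2) (z : R[i]) : bool :=
  eigenvalue (map_mx (real_complex R) A) z.

Definition hurwitz_stable {R : realType} (A : 'M[R]_2) : Prop :=
  forall z : R[i], complex_eigenvalue A z -> complex.Re z < 0.

Definition unstable_mx {R : realType} (A : 'M[R]_2) : Prop :=
  exists2 z : R[i], complex_eigenvalue A z & 0 < complex.Re z.

(* The values at negative times are irrelevant.  Continuity of the label is with
   respect to the discrete topology of nat; [disc k] for k >= 1 are exactly the
   discontinuities, and [disc 0] = 0. *)
Record switching_signal (R : realType) (N : nat) := SwitchingSignal {
  label :> R -> nat;
  disc : nat -> R;
  label_range : forall t : R, 0 <= t -> (1 <= label t <= N)%N;
  disc0 : disc 0 = 0;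
  disc_lt : forall k, disc k < disc k.+1;
  disc_cvg : disc k @[k --> \oo] --> +oo;
  label_right_continuous :
    forall t : R, 0 <= t -> label s @[s --> t^'+] --> label t;
  label_piecewise_constant : forall k s t,
    disc k < s < disc k.+1 -> disc k < t < disc k.+1 -> label s = label t;
  label_discontinuous : forall k, ~ {for disc k.+1, continuous label} }.

(* Membership includes the normalisation sigma(0) = 1. *)
Definition star_governed {R : realType} {N : nat} (sigma : switching_signal R N)
    : Prop :=
  forall k, sigma (disc sigma k.*2) = 1%N /\
            (2 <= sigma (disc sigma k.*2.+1) <= N)%N.

(* Numbered from 0: these are t_(k+1) and s_(k+1) in 1-based numbering. *)
Definition time_center {R : realType} {N : nat} (sigma : switching_signal R N)
    (k : nat) : R :=
  disc sigma k.*2.+1 - disc sigma k.*2.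
Definition time_leaf {R : realType} {N : nat} (sigma : switching_signal R N)
    (k : nat) : R :=
  disc sigma k.*2.+2 - disc sigma k.*2.+1.

Definition dwell_flee {R : realType} {N : nat} (tau eta : R)
    : set (switching_signal R N) :=
  [set sigma | star_governed sigma /\
     forall k, tau <= time_center sigma k /\ time_leaf sigma k <= eta].

Definition dwell_flee' {R : realType} {N : nat} (tau eta : R)
    : set (switching_signal R N) :=
  [set sigma | dwell_flee tau eta sigma /\
     ~ ((time_center sigma k, time_leaf sigma k) @[k --> \oo] --> (tau, eta))].

Definition solution {R : realType} {N : nat} (A : nat -> 'M[R]_2)
    (sigma : switching_signal R N) (x : R -> 'cV[R]_2) : Prop :=
  {within [set t : R | 0 <= t], continuous x} /\
  forall k t, disc sigma k < t < disc sigma k.+1 ->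
    is_derive t (1 : R) x (A (sigma t) *m x t).

Definition stable {R : realType} {N : nat} (A : nat -> 'M[R]_2)
    (sigma : switching_signal R N) : Prop :=
  forall eps : R, 0 < eps -> exists2 delta : R, 0 < delta &
    forall x, solution A sigma x -> eucl_norm (x 0) < delta ->
      forall t, 0 < t -> eucl_norm (x t) < eps.

Definition asymptotically_stable {R : realType} {N : nat} (A : nat -> 'M[R]_2)
    (sigma : switching_signal R N) : Prop :=
  stable A sigma /\
  forall x, solution A sigma x -> eucl_norm (x t) @[t --> +oo] --> (0 : R).

Definition tau12_complex {R : realType} (alpha1 alpha a b c d eta : R) : R :=
  alpha / alpha1 * eta +
  alpha1^-1 * arcosh ((a ^+ 2 + b ^+ 2 + c ^+ 2 + d ^+ 2) / 2).

Definition tau12_defective {R : realType} (alpha1 n c d eta : R) : R :=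
  n / alpha1 * eta + alpha1^-1 * arsinh ((c ^+ 2 + d ^+ 2) / 2 * eta).

Definition tau12_real {R : realType} (alpha1 p q a b c d eta : R) : R :=
  (q + p) / (2 * alpha1) * eta +
  alpha1^-1 * arsinh (Num.sqrt ((a ^+ 2 + b ^+ 2) * (c ^+ 2 + d ^+ 2)) *
                      sinh ((q - p) / 2 * eta)).

(* Main.v *)
Require Import Defs.
From mathcomp Require Import all_boot all_order all_algebra.
From mathcomp Require Import complex ring lra.
From mathcomp Require Import all_classical all_reals all_analysis.

Set Implicit Arguments.
Unset Strict Implicit.
Unset Printing Implicit Defensive.

Import Order.TTheory GRing.Theory Num.Theory.
Import numFieldNormedType.Exports.

Local Open Scope classical_set_scope.
Local Open Scope ring_scope.

(** In the coordinates [y = invmx (P 1) *m x] the center subsystem is a rotation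
    combined with a contraction, so a stay of length [t] multiplies the Euclidean
    norm of [y] by exactly [expR (- alpha 1 * t)].  In the same coordinates a stay
    of length [s] in the leaf [j] acts by [invmx M *m expm (s J_j) *m M] with [M =
    invmx (P j) *m P 1] of determinant 1 or -1.  Up to a scalar factor this
    propagator also has determinant 1, and the operator norm of such a 2x2 matrix
    is a function of its Frobenius norm: the squared singular values are [X] and
    [1/X], with sum the squared Frobenius norm ([eucl_norm_mulmx_le]).  Computing
    Frobenius norms yields the inverse hyperbolic functions in the definition of
    tau; for a spiral leaf it is enough to bound [M] and its inverse separately
    ([spiral_growth], [jordan_growth], [diag_growth]).

    The logarithm of each bound increases with [s] at a rate at least [r], where [r] is
    [alpha j], [n j] or [q j]: the real part of the most unstable eigenvalue,
    which is positive by hypothesis.  Hence a stay of length [s <= eta] expands by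
    at most [expR (alpha 1 * tau - r * (eta - s))], and a pair of stays [(t, s)]
    multiplies the norm by at most [expR (- (alpha 1 * (t - tau) + r * (eta -
    s)))].  This is at most 1, and the expansion inside a leaf never exceeds the
    contraction that preceded it, which gives stability.  The norms at the times
    [d_(2k)] decrease; if their limit is positive then the exponents tend to zero,
    and, being sums of two nonnegative terms, they do so only if [(t_k, s_k)]
    converges to [(tau, eta)] ([alternating_decay]). *)

(** * Hyperbolic functions *)

Lemma sinhD (R : realType) (x y : R) :
  sinh (x + y) = sinh x * cosh y + cosh x * sinh y.
Proof. by rewrite /sinh /cosh opprD !expRD; field. Qed.

Lemma cosh_gt0 (R : realType) (x : R) : 0 < cosh x.
Proof. by rewrite /cosh; have := expR_gt0 x; have := expR_gt0 (- x); lra. Qed.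

Lemma cosh2 (R : realType) (x : R) : cosh x ^+ 2 = 1 + sinh x ^+ 2.
Proof.
by rewrite /cosh /sinh; have := expRxMexpNx_1 x; move: (expR x) (expR _) => e f ef; lra.
Qed.

Lemma expR_double_cosh (R : realType) (x : R) :
  expR (2 * x) + (expR (2 * x))^-1 = 2 + 4 * sinh x ^+ 2.
Proof.
rewrite -expRN !mulr2n mulrDl mul1r opprD !expRD /sinh.
by have := expRxMexpNx_1 x; move: (expR x) (expR _) => e f ef; lra.
Qed.

Lemma ler_sinh (R : realType) (x y : R) : (sinh x <= sinh y) = (x <= y).
Proof.
have mono (u v : R) : u < v -> sinh u < sinh v.
  move=> uv; rewrite /sinh.
  have : expR u < expR v by rewrite ltr_expR.
  have : expR (- v) < expR (- u) by rewrite ltr_expR ltrN2.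
  lra.
exact: (le_mono mono).
Qed.

Lemma sinh0 (R : realType) : sinh 0 = 0 :> R.
Proof. by rewrite /sinh oppr0 subrr mul0r. Qed.

Lemma sinh_ge0 (R : realType) (x : R) : 0 <= x -> 0 <= sinh x.
Proof. by rewrite -{2}(sinh0 R) ler_sinh. Qed.

(** The positive root of [e - 1/e = 2 y] is [y + sqrt (1 + y^2)]. *)
Lemma arsinhK (R : realType) (y : R) : sinh (arsinh y) = y.
Proof.
apply: pinvK; rewrite inE /=.
set r := Num.sqrt (1 + y ^+ 2).
have r2 : r ^+ 2 = 1 + y ^+ 2 by rewrite sqr_sqrtr// addr_ge0// sqr_ge0.
have r_ge0 : 0 <= r by exact: sqrtr_ge0.
have yr_gt0 : 0 < y + r.
  rewrite ltNge; apply/negP => yr.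
  have : r ^+ 2 <= (- y) ^+ 2 by rewrite lerXn2r ?nnegrE//; lra.
  by rewrite r2; lra.
exists (ln (y + r)) => //.
rewrite /sinh expRN !lnK ?posrE//.
have -> : (y + r)^-1 = r - y.
  by apply: (mulfI (lt0r_neq0 yr_gt0)); rewrite mulfV ?lt0r_neq0//; lra.
by field.
Qed.

Lemma ler_arsinh (R : realType) (x y : R) : (arsinh x <= arsinh y) = (x <= y).
Proof. by rewrite -(ler_sinh (arsinh x)) !arsinhK. Qed.

Lemma arsinh_ge0 (R : realType) (y : R) : 0 <= y -> 0 <= arsinh y.
Proof. by move=> y0; rewrite -ler_sinh arsinhK sinh0. Qed.

Lemma arcosh_spec (R : realType) (y : R) : 1 <= y ->
  0 <= arcosh y /\ cosh (arcosh y) = y.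
Proof.
move=> y1; rewrite /arcosh.
have ysurj : y \in cosh @` [set x : R | 0 <= x].
  rewrite inE /=; set r := Num.sqrt (y ^+ 2 - 1).
  have r2 : r ^+ 2 = y ^+ 2 - 1 by rewrite sqr_sqrtr//; nra.
  have r_ge0 : 0 <= r by exact: sqrtr_ge0.
  have yr_ge1 : 1 <= y + r by lra.
  have yr_gt0 : 0 < y + r by lra.
  exists (ln (y + r)); first by rewrite /= ln_ge0.
  rewrite /cosh expRN !lnK ?posrE//.
  have -> : (y + r)^-1 = y - r.
    by apply: (mulfI (lt0r_neq0 yr_gt0)); rewrite mulfV ?lt0r_neq0//; lra.
  by field.
split; last exact: pinvK.
have := @surjpinv_image_sub _ _ (fun=> 0) [set x : R | 0 <= x] _ cosh (@subset_refl _ _).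
by apply; exists y => //; rewrite -inE.
Qed.

(** The slope of [x |-> arsinh (g * sinh x)] is [g cosh x / sqrt (1 + g^2
    sinh^2 x)], which is at least [1] when [1 <= g]; the addition formula for
    [sinh] turns this into an argument free of derivatives. *)
Lemma arsinh_mul_sinh_gap (R : realType) (g x y : R) : 1 <= g -> 0 <= x <= y ->
  arsinh (g * sinh x) + (y - x) <= arsinh (g * sinh y).
Proof.
move=> g1 /andP[x0 xy].
have [d -> d0] : exists2 d, y = x + d & 0 <= d by exists (y - x); lra.
have sd := sinh_ge0 d0.
rewrite -ler_sinh arsinhK addrAC subrr add0r sinhD arsinhK sinhD.
suff h : cosh (arsinh (g * sinh x)) <= g * cosh x.
  have := ler_wpM2r sd h; rewrite !mulrDr !mulrA. lra.
have g0 : 0 <= g by lra.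
rewrite -(@ler_pXn2r _ 2%N)// ?nnegrE ?(mulr_ge0 g0) ?(ltW (cosh_gt0 _))//.
rewrite [leRHS]exprMn !cosh2 arsinhK.
by nra.
Qed.

(** * The Euclidean norm in the plane *)

Lemma sum_ord2 (V : nmodType) (F : 'I_2 -> V) : \sum_i F i = F 0 + F 1.
Proof. by rewrite !big_ord_recl big_ord0 addr0; congr (_ + F _); exact/val_inj. Qed.

Lemma eucl_normE (R : realType) (v : 'cV[R]_2) :
  eucl_norm v = Num.sqrt (v 0 0 ^+ 2 + v 1 0 ^+ 2).
Proof. by rewrite /eucl_norm sum_ord2. Qed.

Lemma eucl_norm_ge0 (R : realType) (v : 'cV[R]_2) : 0 <= eucl_norm v.
Proof. exact: sqrtr_ge0. Qed.

Lemma sqr_eucl_norm (R : realType) (v : 'cV[R]_2) :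
  eucl_norm v ^+ 2 = v 0 0 ^+ 2 + v 1 0 ^+ 2.
Proof. by rewrite eucl_normE sqr_sqrtr// addr_ge0// sqr_ge0. Qed.

Lemma ler_eucl_norm (R : realType) (C : R) (u v : 'cV[R]_2) : 0 <= C ->
  v 0 0 ^+ 2 + v 1 0 ^+ 2 <= C ^+ 2 * (u 0 0 ^+ 2 + u 1 0 ^+ 2) ->
  eucl_norm v <= C * eucl_norm u.
Proof.
move=> C0 h; rewrite -(@ler_pXn2r _ 2%N) ?nnegrE ?(mulr_ge0 C0) ?eucl_norm_ge0//.
by rewrite exprMn !sqr_eucl_norm.
Qed.

Lemma mulmx22 (R : realType) (B : 'M[R]_2) (u : 'cV[R]_2) i :
  (B *m u) i 0 = B i 0 * u 0 0 + B i 1 * u 1 0.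
Proof. by rewrite mxE sum_ord2. Qed.

Lemma det22 (R : realType) (B : 'M[R]_2) : \det B = B 0 0 * B 1 1 - B 0 1 * B 1 0.
Proof.
rewrite (expand_det_row _ 0) sum_ord2 /cofactor !det_mx11 !mxE /= expr0 expr1.
rewrite mul1r mulN1r mulrN.
by congr (_ * B _ _ - _ * B _ _); apply/val_inj.
Qed.

(** The squared Frobenius norm. *)
Definition frob2 (R : realType) (B : 'M[R]_2) : R :=
  B 0 0 ^+ 2 + B 0 1 ^+ 2 + B 1 0 ^+ 2 + B 1 1 ^+ 2.

Lemma eucl_norm_mulmx_bounded (R : realType) (B : 'M[R]_2) :
  exists2 K : R, 0 < K & forall u, eucl_norm (B *m u) <= K * eucl_norm u.
Proof.
exists (1 + frob2 B) => [|u].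
  by rewrite ltr_pwDl// !addr_ge0// sqr_ge0.
have f0 : 0 <= frob2 B by rewrite !addr_ge0// sqr_ge0.
apply: ler_eucl_norm; first by rewrite addr_ge0.
rewrite !mulmx22; apply: (@le_trans _ _ (frob2 B * (u 0 0 ^+ 2 + u 1 0 ^+ 2))).
  rewrite /frob2; move: (B 0 0) (B 0 1) (B 1 0) (B 1 1) (u 0 0) (u 1 0) => a b c d x y.
  have := sqr_ge0 (a * y - b * x); have := sqr_ge0 (c * y - d * x); lra.
by apply: ler_wpM2r; [rewrite addr_ge0// sqr_ge0 | nra].
Qed.

(** Multiplied by its trace [p + q], a form of determinant zero becomes a sum of
    two squares; if the trace is zero too, the form vanishes. *)
Lemma degenerate_form_ge0 (R : realType) (p q r x y : R) :
  0 <= p + q -> p * q = r ^+ 2 -> 0 <= p * x ^+ 2 - 2 * r * x * y + q * y ^+ 2.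
Proof.
move=> pq0 pqr.
have [pq|pq] := ltP 0 (p + q).
  rewrite -(pmulr_rge0 _ pq).
  have -> : (p + q) * (p * x ^+ 2 - 2 * r * x * y + q * y ^+ 2) =
            (p * x - r * y) ^+ 2 + (r * x - q * y) ^+ 2.
    have -> : (p * x - r * y) ^+ 2 + (r * x - q * y) ^+ 2 =
        p ^+ 2 * x ^+ 2 + q ^+ 2 * y ^+ 2 + r ^+ 2 * (x ^+ 2 + y ^+ 2)
        - 2 * r * x * y * (p + q) by ring.
    by rewrite -pqr; ring.
  by rewrite addr_ge0// sqr_ge0.
have qE : q = - p by lra.
have r0 : r = 0.
  apply/eqP; rewrite -sqrf_eq0 -pqr qE; apply/eqP; move: pqr; rewrite qE.
  by have := sqr_ge0 p; have := sqr_ge0 r; lra.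
have p0 : p = 0.
  by apply/eqP; rewrite -sqrf_eq0; apply/eqP; move: pqr; rewrite qE r0; lra.
by rewrite qE p0 r0; lra.
Qed.

(** If [det B = +-1], the squared singular values of [B] are inverse to each
    other and add up to the squared Frobenius norm, so the latter determines
    the operator norm. *)
Lemma eucl_norm_mulmx_le (R : realType) (B : 'M[R]_2) (s : R) (u : 'cV[R]_2) :
  0 <= s -> \det B ^+ 2 = 1 ->
  frob2 B = expR (2 * s) + (expR (2 * s))^-1 ->
  eucl_norm (B *m u) <= expR s * eucl_norm u.
Proof.
move=> s0; rewrite det22 => detB fB; apply: ler_eucl_norm; first exact: expR_ge0.
have -> : expR s ^+ 2 = expR (2 * s) by rewrite -expRM_natl.
have X1 : 1 <= expR (2 * s) by rewrite -[leLHS]expR0 ler_expR; lra.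
rewrite !mulmx22; move: fB X1 detB; rewrite /frob2.
move: (expR (2 * s)) (B 0 0) (B 0 1) (B 1 0) (B 1 1) (u 0 0) (u 1 0).
move=> X a b c d x y fB X1 detB.
have XX : X * X^-1 = 1 by rewrite mulfV//; apply/lt0r_neq0; lra.
rewrite -subr_ge0.
have -> : X * (x ^+ 2 + y ^+ 2) - ((a * x + b * y) ^+ 2 + (c * x + d * y) ^+ 2) =
  (X - a ^+ 2 - c ^+ 2) * x ^+ 2 - 2 * (a * b + c * d) * x * y
  + (X - b ^+ 2 - d ^+ 2) * y ^+ 2 by ring.
apply: degenerate_form_ge0.
  have : X^-1 <= 1 by rewrite invf_le1//; lra.
  lra.
(* [X] is an eigenvalue of the Gram matrix of [B]. *)
have XF : X * (a ^+ 2 + b ^+ 2 + c ^+ 2 + d ^+ 2) = X ^+ 2 + 1.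
  by rewrite fB mulrDr XX; ring.
transitivity (X ^+ 2 - X * (a ^+ 2 + b ^+ 2 + c ^+ 2 + d ^+ 2)
  + (a * d - b * c) ^+ 2 + (a * b + c * d) ^+ 2); first by ring.
by rewrite XF detB; ring.
Qed.

(** * Planar linear flows *)

(** The condition is imposed on the two coordinates, so that the scalar rules of
    differentiation apply directly. *)
Definition linear_flow (R : realType) (A : 'M[R]_2) (s t : R) (z : R -> 'cV[R]_2) :=
  forall i, {within `[s, t], continuous (fun r => z r i 0)} /\
    forall r, s < r < t -> is_derive r 1 (fun r => z r i 0) ((A *m z r) i 0).

Lemma is_derive_coord (R : realType) m (z : R -> 'cV[R]_m) (v : 'cV[R]_m) (r : R) i :
  is_derive r 1 z v -> is_derive r 1 (fun r => z r i 0) (v i 0).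
Proof.
move=> [dz <-]; rewrite derive_mx// mxE; apply/derivableP.
by move/derivable_mxP : dz; exact.
Qed.

Lemma linear_flow_conj (R : realType) (Q A J : 'M[R]_2) (s t : R) z :
  Q *m A = J *m Q -> linear_flow A s t z -> linear_flow J s t (fun r => Q *m z r).
Proof.
move=> QA zA i.
have -> : (fun r => (Q *m z r) i 0) = (fun r => Q i 0 *: z r 0 0 + Q i 1 *: z r 1 0).
  by apply/funext => r; rewrite mulmx22.
split=> [|r rst].
  move=> r; apply: cvgD; (apply: cvgZr; exact: (zA _).1).
rewrite mulmxA -QA -mulmxA mulmx22.
by apply: is_deriveD; apply: is_deriveZ; exact: (zA _).2.
Qed.

(** [r |-> expR (- n * r) * f r] has derivative zero. *)
Lemma exponential_growth (R : realType) (n s t : R) (f : R -> R) : s <= t ->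
  {within `[s, t], continuous f} ->
  (forall r, s < r < t -> is_derive r 1 f (n * f r)) ->
  f t = expR (n * (t - s)) * f s.
Proof.
move=> st cf df; pose g r := expR (- n * r) * f r.
have dg r : r \in `]s, t[%R -> is_derive r 1 g 0.
  rewrite in_itv/= => /df dfr.
  have de : is_derive r 1 (fun r => expR (- n * r)) (expR (- n * r) * - n).
    by apply: is_derive_eq; rewrite /GRing.scale /= mulr1 mulrC.
  apply: is_derive_eq; rewrite /GRing.scale /=; ring.
have cg : {within `[s, t], continuous g}.
  move=> r; apply: cvgM; last exact: cf.
  apply: continuous_subspaceT => {}r.
  apply: continuous_comp; last exact: continuous_expR.
  exact: mulrl_continuous.
have [c _] := MVT_segment st dg cg.
rewrite mul0r => /eqP; rewrite subr_eq0 /g => /eqP gE.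
have -> : f t = expR (n * t) * (expR (- n * t) * f t).
  by rewrite mulrA -expRD mulNr subrr expR0 mul1r.
by rewrite gE mulrA -expRD; congr (expR _ * _); ring.
Qed.

Lemma mx22E (R : realType) (a b c d : R) :
  (mx22 a b c d 0 0 = a) * (mx22 a b c d 0 1 = b) *
  (mx22 a b c d 1 0 = c) * (mx22 a b c d 1 1 = d).
Proof. by rewrite !mxE. Qed.

Lemma spiral_flow (R : realType) (al be s t : R) z : s <= t ->
  linear_flow (mx22 al be (- be) al) s t z ->
  eucl_norm (z t) = expR (al * (t - s)) * eucl_norm (z s).
Proof.
move=> st zJ.
pose f r := z r 0 0 * z r 0 0 + z r 1 0 * z r 1 0.
have fE r : f r = eucl_norm (z r) ^+ 2 by rewrite sqr_eucl_norm.
apply/eqP; rewrite -(@eqrXn2 _ 2%N) ?mulr_ge0 ?expR_ge0 ?eucl_norm_ge0//.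
rewrite exprMn -!fE -expRM_natl; apply/eqP.
have -> : 2%:R * (al * (t - s)) = 2 * al * (t - s) by ring.
apply: exponential_growth => // [|r rst].
  by move=> r; apply: cvgD; apply: cvgM; exact: (zJ _).1.
have d0 := (zJ 0).2 r rst; have d1 := (zJ 1).2 r rst.
rewrite !mulmx22 !mx22E in d0 d1.
by apply: is_derive_eq; rewrite /f /GRing.scale /=; ring.
Qed.

Lemma jordan_flow (R : realType) (n s t : R) z : s <= t ->
  linear_flow (mx22 n 1 0 n) s t z ->
  z t = expR (n * (t - s)) *: (mx22 1 (t - s) 0 1 *m z s).
Proof.
move=> st zJ.
have d0 r (rst : s < r < t) := (zJ 0).2 r rst.
have d1 r (rst : s < r < t) := (zJ 1).2 r rst.
have z1E : z t 1 0 = expR (n * (t - s)) * z s 1 0.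
  apply: (exponential_growth st (zJ 1).1) => r /d1.
  by rewrite mulmx22 !mx22E mul0r add0r.
pose f r := z r 0 0 - (r - s) * z r 1 0.
have fE : f t = expR (n * (t - s)) * f s.
  apply: exponential_growth => // [|r rst].
    have cB : {within `[s, t], continuous (fun r => r - s)}.
      apply: continuous_subspaceT => {}r.
      by apply: cvgB; [exact: cvg_id|exact: cvg_cst].
    move=> r; apply: cvgB; first exact: (zJ 0).1.
    by apply: cvgM; [exact: cB|exact: (zJ 1).1].
  have := d0 r rst; have := d1 r rst; rewrite !mulmx22 !mx22E => e1 e0.
  by apply: is_derive_eq; rewrite /f /GRing.scale /=; ring.
apply/colP => i; rewrite [RHS]mxE mulmx22.
have /orP[/eqP->|/eqP->] : (i == 0) || (i == 1) by case: i => -[|[|]].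
  by rewrite !mx22E; move: fE; rewrite /f z1E; lra.
by rewrite !mx22E z1E; ring.
Qed.

Lemma diag_flow (R : realType) (p q s t : R) z : s <= t ->
  linear_flow (mx22 p 0 0 q) s t z ->
  z t = mx22 (expR (p * (t - s))) 0 0 (expR (q * (t - s))) *m z s.
Proof.
move=> st zJ.
have z0E : z t 0 0 = expR (p * (t - s)) * z s 0 0.
  apply: (exponential_growth st (zJ 0).1) => r /((zJ 0).2 r).
  by rewrite mulmx22 !mx22E mul0r addr0.
have z1E : z t 1 0 = expR (q * (t - s)) * z s 1 0.
  apply: (exponential_growth st (zJ 1).1) => r /((zJ 1).2 r).
  by rewrite mulmx22 !mx22E mul0r add0r.
apply/colP => i; rewrite [RHS]mulmx22.
have /orP[/eqP->|/eqP->] : (i == 0) || (i == 1) by case: i => -[|[|]].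
  by rewrite !mx22E z0E; ring.
by rewrite !mx22E z1E; ring.
Qed.

(** * Growth of the norm over one stay in a leaf *)

(** A determinant [D] with [D ^+ 2 = 1] is its own inverse, so [D] times the
    adjugate is the inverse matrix. *)
Lemma mx22_unitdetK (R : realType) (a b c d : R) (u : 'cV[R]_2) :
  let D := \det (mx22 a b c d) in D ^+ 2 = 1 ->
  mx22 (D * d) (- (D * b)) (- (D * c)) (D * a) *m (mx22 a b c d *m u) = u.
Proof.
move=> D D2; apply/colP => i; rewrite !mulmx22.
move: D2; rewrite /D det22 !mx22E => D2.
have /orP[/eqP->|/eqP->] : (i == 0) || (i == 1) by case: i => -[|[|]].
  rewrite !mx22E; transitivity ((a * d - b * c) ^+ 2 * u 0 0); first by ring.
  by rewrite D2 mul1r.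
rewrite !mx22E; transitivity ((a * d - b * c) ^+ 2 * u 1 0); first by ring.
by rewrite D2 mul1r.
Qed.

Lemma eucl_normZ (R : realType) (k : R) (u : 'cV[R]_2) :
  0 <= k -> eucl_norm (k *: u) = k * eucl_norm u.
Proof.
move=> k0; apply/eqP; rewrite -(@eqrXn2 _ 2%N) ?mulr_ge0 ?eucl_norm_ge0//.
by rewrite exprMn !sqr_eucl_norm !mxE; apply/eqP; ring.
Qed.

(** In the coordinates [M *m y] the spiral flow is a similarity of ratio [expR
    (al * (t - s))], so only [M] and its inverse distort the norm, each by the
    factor [expR (arcosh (frob2 M / 2) / 2)]. *)
Lemma spiral_growth (R : realType) (al be a b c d s t : R) y :
  s <= t -> \det (mx22 a b c d) ^+ 2 = 1 ->
  linear_flow (mx22 al be (- be) al) s t (fun r => mx22 a b c d *m y r) ->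
  eucl_norm (y t) <=
    expR (al * (t - s) + arcosh ((a ^+ 2 + b ^+ 2 + c ^+ 2 + d ^+ 2) / 2)) *
    eucl_norm (y s).
Proof.
move=> st D2 /(spiral_flow st) yt; set th := arcosh _.
have [|th0 chth] := @arcosh_spec R ((a ^+ 2 + b ^+ 2 + c ^+ 2 + d ^+ 2) / 2).
  move: D2; rewrite det22 !mx22E => D2.
  (* The first two squares add up to the squared Frobenius norm minus twice the
     determinant, the last two to the same norm plus twice the determinant. *)
  have := sqr_ge0 (a - d); have := sqr_ge0 (b + c).
  have := sqr_ge0 (a + d); have := sqr_ge0 (b - c).
  have [|] := lerP 0 (a * d - b * c); nra.
have thE : expR (2 * (th / 2)) + (expR (2 * (th / 2)))^-1 =
    a ^+ 2 + b ^+ 2 + c ^+ 2 + d ^+ 2.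
  have -> : 2 * (th / 2) = th by lra.
  by move: chth; rewrite -/th /cosh expRN; lra.
have th20 : 0 <= th / 2 by rewrite divr_ge0.
rewrite -[y t](mx22_unitdetK _ D2); set D := \det _.
have -> : expR (al * (t - s) + th) =
    expR (th / 2) * (expR (al * (t - s)) * expR (th / 2)).
  by rewrite -!expRD; congr expR; lra.
apply: (@le_trans _ _ (expR (th / 2) * eucl_norm (mx22 a b c d *m y t))).
  have D'2 : D ^+ 2 = 1 by [].
  have DE : D = a * d - b * c by rewrite /D det22 !mx22E.
  apply: eucl_norm_mulmx_le => //.
    rewrite det22 !mx22E; transitivity ((D ^+ 2 * (a * d - b * c)) ^+ 2); first by ring.
    by rewrite D'2 mul1r -DE.
  rewrite thE /frob2 !mx22E.
  transitivity (D ^+ 2 * (a ^+ 2 + b ^+ 2 + c ^+ 2 + d ^+ 2)); first by ring.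
  by rewrite D'2 mul1r.
rewrite yt -!mulrA !ler_wpM2l ?expR_ge0//.
by apply: eucl_norm_mulmx_le => //; rewrite thE /frob2 !mx22E.
Qed.

(** The propagator is [expR (n * (t - s))] times a unipotent matrix [1 + N] with
    [N] nilpotent of squared Frobenius norm [((t - s) * (c^2 + d^2))^2], and
    [N] has trace zero, whence [frob2 (1 + N) = 2 + frob2 N]. *)
Lemma jordan_growth (R : realType) (n a b c d s t : R) y :
  s <= t -> \det (mx22 a b c d) ^+ 2 = 1 ->
  linear_flow (mx22 n 1 0 n) s t (fun r => mx22 a b c d *m y r) ->
  eucl_norm (y t) <=
    expR (n * (t - s) + arsinh ((c ^+ 2 + d ^+ 2) / 2 * (t - s))) *
    eucl_norm (y s).
Proof.
move=> st D2 /(jordan_flow st) yt; set h := t - s in yt *.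
have h0 : 0 <= h by rewrite subr_ge0.
set th := arsinh _.
have th0 : 0 <= th by rewrite arsinh_ge0// mulr_ge0// divr_ge0// addr_ge0// sqr_ge0.
have shth : sinh th = (c ^+ 2 + d ^+ 2) / 2 * h by rewrite arsinhK.
rewrite -[y t](mx22_unitdetK _ D2) yt; set D := \det _.
have D'2 : D ^+ 2 = 1 by [].
have DE : D = a * d - b * c by rewrite /D det22 !mx22E.
pose B := mx22 (1 + D * h * c * d) (D * h * d ^+ 2)
  (- (D * h * c ^+ 2)) (1 - D * h * c * d).
rewrite -scalemxAr eucl_normZ ?expR_ge0//.
have -> : mx22 (D * d) (- (D * b)) (- (D * c)) (D * a) *m
    (mx22 1 h 0 1 *m (mx22 a b c d *m y s)) = B *m y s.
  apply/colP => i; rewrite !mulmx22.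
  have /orP[/eqP->|/eqP->] : (i == 0) || (i == 1) by case: i => -[|[|]].
    rewrite !mx22E.
    transitivity ((D * (a * d - b * c) + D * h * c * d) * y s 0 0
                  + D * h * d ^+ 2 * y s 1 0); first by ring.
    by rewrite -DE -expr2 D'2.
  rewrite !mx22E.
  transitivity (- (D * h * c ^+ 2) * y s 0 0
    + (D * (a * d - b * c) - D * h * c * d) * y s 1 0); first by ring.
  by rewrite -DE -expr2 D'2.
rewrite expRD -mulrA ler_wpM2l ?expR_ge0//; apply: eucl_norm_mulmx_le => //.
  by rewrite det22 !mx22E; ring.
rewrite expR_double_cosh shth /frob2 !mx22E.
transitivity (2 + D ^+ 2 * (h * (c ^+ 2 + d ^+ 2)) ^+ 2); first by ring.
by rewrite D'2; field.
Qed.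

Lemma gram_ge1 (R : realType) (a b c d : R) : \det (mx22 a b c d) ^+ 2 = 1 ->
  1 <= (a ^+ 2 + b ^+ 2) * (c ^+ 2 + d ^+ 2).
Proof.
rewrite det22 !mx22E => <-; rewrite -subr_ge0.
by rewrite (_ : _ - _ = (a * c + b * d) ^+ 2) ?sqr_ge0//; ring.
Qed.

(** With [h = (q - p) / 2 * (t - s)], the propagator is [expR ((q + p) / 2 * (t -
    s))] times [cosh h + sinh h K], where [K] is conjugate to [diag(-1, 1)].
    Since [K] has trace zero and [frob2 K = 4 (a^2 + b^2) (c^2 + d^2) - 2], the
    second factor has [frob2] equal to
    [2 + 4 (a^2 + b^2) (c^2 + d^2) (sinh h)^2]. *)
Lemma diag_growth (R : realType) (p q a b c d s t : R) y :
  s <= t -> p <= q -> \det (mx22 a b c d) ^+ 2 = 1 ->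
  linear_flow (mx22 p 0 0 q) s t (fun r => mx22 a b c d *m y r) ->
  eucl_norm (y t) <=
    expR ((q + p) / 2 * (t - s) +
      arsinh (Num.sqrt ((a ^+ 2 + b ^+ 2) * (c ^+ 2 + d ^+ 2)) *
              sinh ((q - p) / 2 * (t - s)))) *
    eucl_norm (y s).
Proof.
move=> st pq D2 /(diag_flow st) yt; set h := (q - p) / 2 * (t - s).
have h0 : 0 <= h by rewrite mulr_ge0 ?divr_ge0 ?subr_ge0.
set g := Num.sqrt _; set th := arsinh _.
have th0 : 0 <= th by rewrite arsinh_ge0// mulr_ge0 ?sqrtr_ge0 ?sinh_ge0.
have shth : sinh th = g * sinh h by rewrite arsinhK.
have g2 : g ^+ 2 = (a ^+ 2 + b ^+ 2) * (c ^+ 2 + d ^+ 2).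
  by rewrite sqr_sqrtr// (le_trans ler01)// gram_ge1.
rewrite -[y t](mx22_unitdetK _ D2) yt; set D := \det _.
have D'2 : D ^+ 2 = 1 by [].
have DE : D = a * d - b * c by rewrite /D det22 !mx22E.
have pE : expR (p * (t - s)) = expR ((q + p) / 2 * (t - s)) * (cosh h - sinh h).
  rewrite (_ : cosh h - sinh h = expR (- h)); last by rewrite /cosh /sinh; lra.
  by rewrite -expRD; congr expR; rewrite /h; field.
have qE : expR (q * (t - s)) = expR ((q + p) / 2 * (t - s)) * (cosh h + sinh h).
  rewrite (_ : cosh h + sinh h = expR h); last by rewrite /cosh /sinh; lra.
  by rewrite -expRD; congr expR; rewrite /h; field.
have -> : expR ((q + p) / 2 * (t - s) + th) = expR th * expR ((q + p) / 2 * (t - s)).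
  by rewrite addrC expRD.
rewrite pE qE; move: (expR ((q + p) / 2 * (t - s))) (expR_ge0 ((q + p) / 2 * (t - s))).
move=> e e0; rewrite -(mulrA (expR th)) -eucl_normZ//; have := cosh2 h.
move: (cosh h) (sinh h) shth => C S shth CS {pE qE}.
pose w := a * d + b * c.
pose B := mx22 (C - D * S * w) (- (2 * D * S * b * d))
  (2 * D * S * a * c) (C + D * S * w).
rewrite (_ : mx22 _ _ _ _ *m _ = e *: (B *m y s)).
  rewrite scalemxAr; apply: eucl_norm_mulmx_le => //.
    rewrite det22 !mx22E.
    transitivity ((C ^+ 2 - (D ^+ 2) * S ^+ 2 * (a * d - b * c) ^+ 2) ^+ 2).
      by rewrite /w; ring.
    by rewrite -DE D'2 CS; ring.
  rewrite expR_double_cosh shth exprMn g2 /frob2 !mx22E.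
  transitivity (2 * C ^+ 2 + D ^+ 2 * S ^+ 2 *
    (4 * ((a ^+ 2 + b ^+ 2) * (c ^+ 2 + d ^+ 2)) - 2 * (a * d - b * c) ^+ 2)).
    by rewrite /w; ring.
  by rewrite -DE D'2 CS; ring.
apply/colP => i; rewrite [RHS]mxE !mulmx22.
have /orP[/eqP->|/eqP->] : (i == 0) || (i == 1) by case: i => -[|[|]].
  rewrite !mx22E.
  transitivity (e * ((C * (D * (a * d - b * c)) - D * S * w) * y s 0 0
                - 2 * D * S * b * d * y s 1 0)); first by rewrite /w; ring.
  by rewrite -DE -expr2 D'2; ring.
rewrite !mx22E.
transitivity (e * (2 * D * S * a * c * y s 0 0 +
  (C * (D * (a * d - b * c)) + D * S * w) * y s 1 0)); first by rewrite /w; ring.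
by rewrite -DE -expr2 D'2; ring.
Qed.

(** * Positive growth rates of the leaves *)

(** Right multiplication by [P] carries the (row) eigenvectors of [A] to those of
    [J]. *)
Lemma unstable_mx_conj (R : realType) (A P J : 'M[R]_2) :
  P \in unitmx -> A = P *m J *m invmx P -> unstable_mx A -> unstable_mx J.
Proof.
move=> uP -> [z /eigenvalueP[v vA v0] zgt0]; exists z => //.
pose f := map_mx (real_complex R).
have uP' : f 2%N 2%N P \in unitmx by rewrite map_unitmx.
apply/eigenvalueP; exists (v *m f _ _ P).
  move: vA; rewrite !map_mxM map_invmx => /(congr1 (fun w => w *m f _ _ P)).
  by rewrite -!mulmxA mulVmx// mulmx1 -scalemxAl !mulmxA.
apply: contra_neq v0 => vP0.
by rewrite -[v](mulmxK uP') vP0 mul0mx.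
Qed.

Lemma complex_eigenvalue22 (R : realType) (J : 'M[R]_2) z :
  complex_eigenvalue J z -> exists x y : R[i],
    [/\ (x != 0) || (y != 0),
        x * (J 0 0)%:C%C + y * (J 1 0)%:C%C = z * x &
        x * (J 0 1)%:C%C + y * (J 1 1)%:C%C = z * y].
Proof.
move=> /eigenvalueP[v /rowP vJ v0]; exists (v 0 0), (v 0 1); split.
- apply: contra_neqT v0; rewrite negb_or !negbK => /andP[/eqP v0 /eqP v1].
  apply/rowP => i; rewrite mxE.
  by have /orP[/eqP->|/eqP->] : (i == 0) || (i == 1) by case: i => -[|[|]].
- by have := vJ 0; rewrite !mxE sum_ord2 !mxE.
- by have := vJ 1; rewrite !mxE sum_ord2 !mxE.
Qed.

Lemma unstable_jordan (R : realType) (n : R) :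
  unstable_mx (mx22 n 1 0 n) -> 0 < n.
Proof.
move=> [z /complex_eigenvalue22[x [y []]]]; rewrite !mx22E rmorph0 rmorph1.
rewrite mulr0 mulr1 addr0 => xy0 ex ey z0.
suff zE : z = n%:C%C by rewrite zE in z0.
have [x0|x0] := eqVneq x 0; last by apply: (mulIf x0); rewrite -ex mulrC.
move: xy0 ey; rewrite x0 eqxx add0r /= => y0 ey.
by apply: (mulIf y0); rewrite -ey mulrC.
Qed.

Lemma unstable_diag (R : realType) (p q : R) : p <= q ->
  unstable_mx (mx22 p 0 0 q) -> 0 < q.
Proof.
move=> pq [z /complex_eigenvalue22[x [y []]]]; rewrite !mx22E rmorph0.
rewrite !mulr0 addr0 add0r => xy0 ex ey z0.
have [x0|x0] := eqVneq x 0; last first.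
  have zE : z = p%:C%C by apply: (mulIf x0); rewrite -ex mulrC.
  by rewrite zE /= in z0; exact: lt_le_trans z0 pq.
move: xy0; rewrite x0 eqxx /= => y0.
have zE : z = q%:C%C by apply: (mulIf y0); rewrite -ey mulrC.
by rewrite zE in z0.
Qed.

(** An eigenvalue [z] satisfies [(z - al)^2 = - be^2], so [z - al] is purely
    imaginary. *)
Lemma unstable_spiral (R : realType) (al be : R) : be != 0 ->
  unstable_mx (mx22 al be (- be) al) -> 0 < al.
Proof.
move=> be0 [z /complex_eigenvalue22[x [y []]]]; rewrite !mx22E rmorphN /=.
move=> xy0 ex ey z0.
have zE : (z - al%:C%C) ^+ 2 + be%:C%C ^+ 2 = 0.
  have e1 : (z - al%:C%C) * x = - be%:C%C * y by rewrite mulrBl -ex; ring.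
  have e2 : (z - al%:C%C) * y = be%:C%C * x by rewrite mulrBl -ey; ring.
  have [x0|x0] := eqVneq x 0.
    move: xy0; rewrite x0 eqxx /= => y0; apply: (mulIf y0).
    rewrite mul0r mulrDl expr2 -mulrA e2.
    transitivity (be%:C%C * ((z - al%:C%C) * x + be%:C%C * y)); first by ring.
    by rewrite e1; ring.
  apply: (mulIf x0); rewrite mul0r mulrDl expr2 -mulrA e1.
  transitivity (- be%:C%C * ((z - al%:C%C) * y - be%:C%C * x)); first by ring.
  by rewrite e2; ring.
case: z z0 zE {ex ey} => u v /= u0.
rewrite !expr2 => /eqP; rewrite eq_complex /= => /andP[/eqP re /eqP im].
have [u_al|u_al] := eqVneq u al; first by rewrite -u_al.
have v0 : v = 0.
  have ual0 : u - al != 0 by rewrite subr_eq0.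
  by apply: (mulfI ual0); lra.
have be2 : 0 < be ^+ 2 by rewrite exprn_even_gt0.
by have := sqr_ge0 (u - al); move: re; rewrite v0; lra.
Qed.

(** * Slack in the dwell time bounds *)

Lemma tau12_complex_slack (R : realType) (al1 al a b c d h eta : R) : 0 < al1 ->
  al * h + arcosh ((a ^+ 2 + b ^+ 2 + c ^+ 2 + d ^+ 2) / 2) =
  al1 * tau12_complex al1 al a b c d eta - al * (eta - h).
Proof.
by move=> al1_gt0; rewrite /tau12_complex; move: (arcosh _) => th; field; lra.
Qed.

Lemma tau12_defective_slack (R : realType) (al1 n c d h eta : R) :
  0 < al1 -> h <= eta ->
  n * h + arsinh ((c ^+ 2 + d ^+ 2) / 2 * h) <=
  al1 * tau12_defective al1 n c d eta - n * (eta - h).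
Proof.
move=> al1_gt0 heta.
have -> : al1 * tau12_defective al1 n c d eta - n * (eta - h) =
    n * h + arsinh ((c ^+ 2 + d ^+ 2) / 2 * eta).
  by rewrite /tau12_defective; move: (arsinh _) => th; field; lra.
rewrite lerD2l ler_arsinh ler_wpM2l// divr_ge0//.
by rewrite addr_ge0// sqr_ge0.
Qed.

(** Although [(q + p) / 2] may be negative, the second summand makes up for it:
    it grows at least at the rate [(q - p) / 2]. *)
Lemma tau12_real_slack (R : realType) (al1 p q a b c d h eta : R) :
  0 < al1 -> p <= q -> \det (mx22 a b c d) ^+ 2 = 1 -> 0 <= h <= eta ->
  (q + p) / 2 * h + arsinh (Num.sqrt ((a ^+ 2 + b ^+ 2) * (c ^+ 2 + d ^+ 2)) *
                            sinh ((q - p) / 2 * h)) <=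
  al1 * tau12_real al1 p q a b c d eta - q * (eta - h).
Proof.
move=> al1_gt0 pq D2 /andP[h0 heta].
set g := Num.sqrt _.
have g1 : 1 <= g by rewrite -[leLHS]sqrtr1 ler_wsqrtr// gram_ge1.
have qp0 : 0 <= (q - p) / 2 by rewrite divr_ge0 ?subr_ge0.
have := @arsinh_mul_sinh_gap R g ((q - p) / 2 * h) ((q - p) / 2 * eta) g1.
rewrite mulr_ge0// ler_wpM2l// => /(_ isT).
have -> : al1 * tau12_real al1 p q a b c d eta =
    (q + p) / 2 * eta + arsinh (g * sinh ((q - p) / 2 * eta)).
  by rewrite /tau12_real -/g; move: (arsinh _) => th; field; lra.
by move: (arsinh _) (arsinh _) => u v; lra.
Qed.

(** * Alternating contraction and expansion *)

(** The leaves are finitely many, so their growth rates have a positive lower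
    bound. *)
Lemma common_positive_rate (R : realType) (N : nat) (Q : nat -> R -> Prop) :
  (forall j r r', r' <= r -> Q j r -> Q j r') ->
  (forall j, (2 <= j <= N)%N -> exists2 r, 0 < r & Q j r) ->
  exists2 r, 0 < r & forall j, (2 <= j <= N)%N -> Q j r.
Proof.
move=> Qanti; elim: N => [_|N IH QN].
  by exists 1 => // j /andP[j2 j0]; have := leq_trans j2 j0.
have [|r r0 Qr] := IH.
  by move=> j /andP[j2 jN]; apply: QN; rewrite j2 leqW.
have [N1|N1] := leqP 2 N.+1; last first.
  by exists 1 => // j /andP[j2 jN]; have := leq_trans N1 (leq_trans j2 jN); rewrite ltnn.
have [|r' r'0 Qr'] := QN N.+1; first by rewrite N1 leqnn.
exists (Num.min r r'); first by rewrite lt_min r0.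
move=> j /andP[j2]; rewrite leq_eqVlt => /orP[/eqP->|jN].
  by apply: Qanti Qr'; rewrite ge_min lexx orbT.
by apply: Qanti (Qr j _); rewrite ?ge_min ?lexx// j2.
Qed.

(** The excess of a stay in the center over [tau] and the deficit of a stay in a
    leaf below [eta] both add to the contraction; [1 + x <= expR x] turns the
    resulting exponential factor into a linear one. *)
Lemma alternating_block (R : realType) (al tau eta r : R) (d : nat -> R)
    (V : R -> R) :
  0 < al -> 0 < r ->
  (forall k, d k < d k.+1) -> (forall t, 0 <= V t) ->
  (forall k t, d k.*2 <= t <= d k.*2.+1 ->
     V t <= expR (- al * (t - d k.*2)) * V (d k.*2)) ->
  (forall k t, d k.*2.+1 <= t <= d k.*2.+2 ->
     V t <= expR (al * tau - r * (eta - (t - d k.*2.+1))) * V (d k.*2.+1)) ->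
  (forall k, tau <= d k.*2.+1 - d k.*2 /\ d k.*2.+2 - d k.*2.+1 <= eta) ->
  (forall k t, d k.*2 <= t <= d k.+1.*2 -> V t <= V (d k.*2)) /\
  (forall k, V (d k.+1.*2) * (1 + (al * (d k.*2.+1 - d k.*2 - tau) +
      r * (eta - (d k.*2.+2 - d k.*2.+1)))) <= V (d k.*2)).
Proof.
move=> al0 r0 dlt V0 Vc Vl dwell.
have leaf k t : d k.*2.+1 <= t <= d k.*2.+2 ->
    V t * expR (al * (d k.*2.+1 - d k.*2 - tau) + r * (eta - (t - d k.*2.+1)))
    <= V (d k.*2).
  move=> tk; have Vt := Vl k t tk.
  have := Vc k (d k.*2.+1); rewrite lexx andbT ltW// => /(_ isT) Vd.
  rewrite -ler_pdivlMr ?expR_gt0// -expRN mulrC.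
  apply: (le_trans Vt).
  rewrite -(ler_pM2l (expR_gt0 (al * tau - r * (eta - (t - d k.*2.+1))))) in Vd.
  apply: (le_trans Vd); rewrite mulrA -expRD.
  by rewrite le_eqVlt; apply/orP; left; apply/eqP; congr (expR _ * _); ring.
split=> [k t /andP[t1 t2]|k].
  have [tc|tc] := leP t (d k.*2.+1).
    have := Vc k t; rewrite t1 tc => /(_ isT) /le_trans; apply.
    rewrite ler_piMl// -[leRHS]expR0 ler_expR mulNr oppr_le0.
    by apply: mulr_ge0; lra.
  have := leaf k t; rewrite ltW//= => /(_ t2); apply: le_trans.
  rewrite ler_peMr// -[leLHS]expR0 ler_expR.
  by have [dc dl] := dwell k; apply: addr_ge0; apply: mulr_ge0; lra.
have := leaf k (d k.*2.+2); rewrite lexx andbT ltW// => /(_ isT).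
by apply: le_trans; apply: ler_wpM2l => //; exact: expR_ge1Dx.
Qed.

Lemma le_block_start (R : realType) (d : nat -> R) (V : R -> R) :
  (forall k, d k < d k.+1) -> d k @[k --> \oo] --> +oo ->
  (forall k t, d k.*2 <= t <= d k.+1.*2 -> V t <= V (d k.*2)) ->
  forall k t, d k.*2 <= t -> V t <= V (d k.*2).
Proof.
move=> dlt dcvg Vblock.
have dle : {homo d : m n / (m <= n)%N >-> m <= n}.
  by apply/nondecreasing_seqP => k; exact: ltW.
have finite n k t : d k.*2 <= t <= d (n + k).*2 -> V t <= V (d k.*2).
  elim: n k => [|n IH] k /andP[t1 t2].
    by suff -> : t = d k.*2 by []; apply/eqP; rewrite eq_le t1 t2.
  have [tk|tk] := leP t (d k.+1.*2); first by apply: Vblock; rewrite t1.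
  apply: (@le_trans _ _ (V (d k.+1.*2))).
    by apply: IH; rewrite ltW//= addnS -addSn.
  by apply: Vblock; rewrite lexx andbT dle// leq_double.
move=> k t tk.
have [n _ /(_ n (leqnn n)) /= tn] := (cvgryPge _).1 dcvg t.
apply: (finite n); rewrite tk (le_trans tn)//; apply: dle.
by rewrite -addnn (leq_trans (leq_addr k n))// leq_addr.
Qed.

(** The values [V (d k.*2)] decrease to a limit [L].  If [0 < L], the excess
    [x k] in the block estimate satisfies [L * x k <= V (d k.*2) - V (d
    k.+1.*2)] and tends to zero, which forces both its nonnegative summands to
    do so. *)
Lemma alternating_decay (R : realType) (al tau eta r : R) (d : nat -> R)
    (V : R -> R) :
  0 < al -> 0 < r ->
  (forall k, d k < d k.+1) -> d k @[k --> \oo] --> +oo ->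
  (forall t, 0 <= V t) ->
  (forall k t, d k.*2 <= t <= d k.+1.*2 -> V t <= V (d k.*2)) ->
  (forall k, V (d k.+1.*2) * (1 + (al * (d k.*2.+1 - d k.*2 - tau) +
      r * (eta - (d k.*2.+2 - d k.*2.+1)))) <= V (d k.*2)) ->
  (forall k, tau <= d k.*2.+1 - d k.*2 /\ d k.*2.+2 - d k.*2.+1 <= eta) ->
  ~ ((d k.*2.+1 - d k.*2, d k.*2.+2 - d k.*2.+1) @[k --> \oo] --> (tau, eta)) ->
  V t @[t --> +oo] --> (0 : R).
Proof.
move=> al0 r0 dlt dcvg V0 Vblock Vstep dwell ncvg.
have Vle := le_block_start dlt dcvg Vblock.
pose W k := V (d k.*2).
have Wni : nonincreasing_seq W.
  apply/nonincreasing_seqP => k; apply: Vblock; rewrite lexx andbT.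
  by rewrite ltW// (lt_trans (dlt _)).
have Wlb : has_lbound (range W) by exists 0 => _ [k _ <-]; exact: V0.
have Wcvg := nonincreasing_is_cvgn Wni Wlb.
have LW k : limn W <= W k := nonincreasing_cvgn_ge Wni Wcvg k.
have L0 : 0 <= limn W by apply: limr_ge => //; apply: nearW => k; exact: V0 (d k.*2).
have [L_gt0|L_le0] := ltP 0 (limn W); last first.
  have WL : W k @[k --> \oo] --> (0 : R).
    by rewrite -(_ : limn W = 0)//; apply/eqP; rewrite eq_le L_le0.
  apply/cvgrPdist_lt => e e0.
  have [k _ /(_ k (leqnn k)) /=] := (cvgrPdist_lt _ _).1 WL e e0.
  rewrite sub0r normrN ger0_norm; last exact: V0 (d k.*2).
  move=> We.
  near=> t; rewrite sub0r normrN (ger0_norm (V0 t)); apply: le_lt_trans We.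
  by apply: Vle; near: t; apply: nbhs_pinfty_ge; exact: num_real.
exfalso; apply: ncvg.
pose x k := al * (d k.*2.+1 - d k.*2 - tau) + r * (eta - (d k.*2.+2 - d k.*2.+1)).
have xle k : 0 <= d k.*2.+1 - d k.*2 - tau <= x k / al /\
    0 <= eta - (d k.*2.+2 - d k.*2.+1) <= x k / r.
  have [dc dl] := dwell k.
  have c0 : 0 <= d k.*2.+1 - d k.*2 - tau by lra.
  have l0 : 0 <= eta - (d k.*2.+2 - d k.*2.+1) by lra.
  rewrite c0 l0 !ler_pdivlMr// /x; have := mulr_ge0 (ltW al0) c0.
  by have := mulr_ge0 (ltW r0) l0; split; lra.
have x0 k : 0 <= x k.
  have [/andP[c0 c1] _] := xle k.
  by have := le_trans c0 c1; rewrite pmulr_lge0// invr_gt0.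
have xcvg : x k @[k --> \oo] --> (0 : R).
  have Wd : (W k - W k.+1) / limn W @[k --> \oo] --> (0 : R).
    rewrite -(mul0r (limn W)^-1); apply: cvgMl.
    rewrite -(subrr (limn W)); apply: cvgB => //.
    by have := Wcvg; rewrite -(cvg_shiftS W).
  apply: squeeze_cvgr Wd; last exact: cvg_cst.
  apply: nearW => k; rewrite x0 ler_pdivlMr//=.
  have := Vstep k; rewrite -/(x k) -/(W k) -/(W k.+1) => Ws.
  have := ler_wpM2l (x0 k) (LW k.+1); lra.
have tcvg : d k.*2.+1 - d k.*2 @[k --> \oo] --> tau.
  apply/subr_cvg0; apply: (@squeeze_cvgr _ _ _ _ (fun=> 0) (fun k => x k / al)).
  - by apply: nearW => k; exact: (xle k).1.
  - exact: cvg_cst.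
  - by rewrite -(mul0r al^-1); exact: cvgMl.
have scvg : d k.*2.+2 - d k.*2.+1 @[k --> \oo] --> eta.
  apply/subr_cvg0; apply: (@squeeze_cvgr _ _ _ _ (fun k => - (x k / r)) (fun=> 0)).
  - by apply: nearW => k; have [_ /andP[s0 s1]] := xle k; apply/andP; split; lra.
  - by rewrite -oppr0 -(mul0r r^-1); apply: cvgN; exact: cvgMl.
  - exact: cvg_cst.
exact: cvg_pair tcvg scvg.
Unshelve. all: by end_near. Qed.

(** * Solutions of the switched system *)

Lemma disc_le (R : realType) (N : nat) (sigma : switching_signal R N) :
  {homo disc sigma : m n / (m <= n)%N >-> m <= n}.
Proof. by apply/nondecreasing_seqP => k; exact: ltW (disc_lt sigma k). Qed.

Lemma disc_ge0 (R : realType) (N : nat) (sigma : switching_signal R N) k :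
  0 <= disc sigma k.
Proof. by rewrite -(disc0 sigma) disc_le. Qed.

(** Right continuity at [disc sigma k] identifies the constant value of the label
    on the following open interval. *)
Lemma label_constant (R : realType) (N : nat) (sigma : switching_signal R N) k t :
  disc sigma k < t < disc sigma k.+1 -> sigma t = sigma (disc sigma k).
Proof.
move=> kt.
have := @label_right_continuous _ _ sigma _ (disc_ge0 sigma k).
move=> /(_ _ (discrete_set1 (sigma (disc sigma k)))) near_eq.
have lt_right := nbhs_right_lt (disc_lt sigma k).
have gt_right := nbhs_right_gt (disc sigma k).
have [s [[ds sd] ss]] := filter_ex (filterI (filterI gt_right lt_right) near_eq).
by rewrite -ss; apply: label_piecewise_constant kt _; rewrite ds.
Qed.

Lemma solution_linear_flow (R : realType) (N : nat) (A : nat -> 'M[R]_2)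
    (sigma : switching_signal R N) x k t :
  solution A sigma x -> disc sigma k <= t <= disc sigma k.+1 ->
  linear_flow (A (sigma (disc sigma k))) (disc sigma k) t x.
Proof.
move=> [cx dx] /andP[kt tk] i; split=> [|r /andP[kr rt]].
  have : {within `[disc sigma k, t], continuous x}.
    apply: continuous_subspaceW cx => r /=; rewrite in_itv /= => /andP[kr _].
    exact: le_trans (disc_ge0 sigma k) kr.
  move=> cx' r.
  apply: (@continuous_comp (subspace `[disc sigma k, t]) _ _ x
    (fun v : 'cV[R]_2 => v i 0)).
    exact: cx'.
  exact: coord_continuous.
have kr' : disc sigma k < r < disc sigma k.+1 by rewrite kr (lt_le_trans rt).
by apply: is_derive_coord; rewrite -(label_constant kr'); exact: dx kr'.
Qed.

(** In the coordinates [invmx (P 1) *m x] the center contracts by exactly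
    [expR (- al * _)], and a leaf with the uniform estimate assumed here expands
    by at most what a dwell time [tau] in the center has gained. *)
Lemma star_switched_decay (R : realType) (N : nat) (A : nat -> 'M[R]_2)
    (P : 'M[R]_2) (al be tau eta r : R) (sigma : switching_signal R N) x :
  0 < al -> 0 < r -> P \in unitmx ->
  A 1%N = P *m mx22 (- al) be (- be) (- al) *m invmx P ->
  (forall j s t z, (2 <= j <= N)%N -> 0 <= t - s <= eta -> linear_flow (A j) s t z ->
     eucl_norm (invmx P *m z t) <=
       expR (al * tau - r * (eta - (t - s))) * eucl_norm (invmx P *m z s)) ->
  dwell_flee tau eta sigma -> solution A sigma x ->
  (forall t, 0 <= t -> eucl_norm (invmx P *m x t) <= eucl_norm (invmx P *m x 0)) /\
  (~ ((time_center sigma k, time_leaf sigma k) @[k --> \oo] --> (tau, eta)) ->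
   eucl_norm (invmx P *m x t) @[t --> +oo] --> (0 : R)).
Proof.
move=> al0 r0 uP A1 leafP [star dwell] xsol.
pose V t := eucl_norm (invmx P *m x t).
have V0 t : 0 <= V t by exact: eucl_norm_ge0.
have Vc k t : disc sigma k.*2 <= t <= disc sigma k.*2.+1 ->
    V t <= expR (- al * (t - disc sigma k.*2)) * V (disc sigma k.*2).
  move=> kt; have /andP[kt1 _] := kt; rewrite le_eqVlt; apply/orP; left; apply/eqP.
  have := solution_linear_flow xsol kt; rewrite (star k).1 A1 => flow.
  apply: (@spiral_flow R (- al) be _ _ (fun r => invmx P *m x r) kt1).
  by apply: linear_flow_conj flow; rewrite !mulmxA mulVmx// mul1mx.
have Vl k t : disc sigma k.*2.+1 <= t <= disc sigma k.*2.+2 ->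
    V t <= expR (al * tau - r * (eta - (t - disc sigma k.*2.+1))) *
           V (disc sigma k.*2.+1).
  move=> kt; have := solution_linear_flow xsol kt.
  apply: leafP (star k).2 _.
  have := (dwell k).2; rewrite /time_leaf; move/andP: kt => [kt1 kt2].
  by move=> ?; apply/andP; split; lra.
have dlt := disc_lt sigma.
have [Vblock Vstep] := alternating_block al0 r0 dlt V0 Vc Vl dwell.
have Vle := le_block_start dlt (disc_cvg sigma) Vblock.
split=> [t t0|ncvg].
  by have := Vle 0%N t; rewrite disc0; exact.
exact: alternating_decay al0 r0 dlt (disc_cvg sigma) V0 Vblock Vstep dwell ncvg.
Qed.

Theorem theorem13p5 (R : realType) (N k l : nat)
  (A P J : nat -> 'M[R]_2) (alpha beta n p q a b c d : nat -> R)
  (hP : forall j, (1 <= j <= N)%N -> P j \in unitmx)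
  (hA : forall j, (1 <= j <= N)%N -> A j = P j *m J j *m invmx (P j))
  (hA1 : hurwitz_stable (A 1%N))
  (hAj : forall j, (2 <= j <= N)%N -> unstable_mx (A j))
  (hPP : forall j, (2 <= j <= N)%N ->
     invmx (P j) *m P 1%N = mx22 (a j) (b j) (c j) (d j))
  (hdet : forall j, (2 <= j <= N)%N ->
     \det (invmx (P j) *m P 1%N) = 1 \/ \det (invmx (P j) *m P 1%N) = -1)
  (hJ1 : J 1%N = mx22 (- alpha 1%N) (beta 1%N) (- beta 1%N) (- alpha 1%N))
  (halpha1 : 0 < alpha 1%N) (hbeta1 : beta 1%N != 0)
  (hkl : (k + l + 1 <= N)%N)
  (hJcomplex : forall j, (2 <= j <= k + 1)%N ->
     [/\ J j = mx22 (alpha j) (beta j) (- beta j) (alpha j),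
         0 <= alpha j & beta j != 0])
  (hJdefective : forall j, (k + 1 < j <= k + l + 1)%N ->
     J j = mx22 (n j) 1 0 (n j) /\ 0 <= n j)
  (hJreal : forall j, (k + l + 1 < j <= N)%N ->
     [/\ J j = mx22 (p j) 0 0 (q j), p j <= q j & (p j, q j) != (0, 0)])
  (tau12 : nat -> R -> R)
  (htau_complex : forall (j : nat) (eta : R), (2 <= j <= k + 1)%N -> 0 < eta ->
     tau12 j eta =
       tau12_complex (alpha 1%N) (alpha j) (a j) (b j) (c j) (d j) eta)
  (htau_defective : forall (j : nat) (eta : R), (k + 1 < j <= k + l + 1)%N -> 0 < eta ->
     tau12 j eta = tau12_defective (alpha 1%N) (n j) (c j) (d j) eta)
  (htau_real : forall (j : nat) (eta : R), (k + l + 1 < j <= N)%N -> 0 < eta ->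
     tau12 j eta =
       tau12_real (alpha 1%N) (p j) (q j) (a j) (b j) (c j) (d j) eta)
  (eta : R) (heta : 0 < eta)
  (tau : R)
  (* the default tau12 2 eta is one of the terms as soon as 2 <= N;
     for N = 1 there is no switching signal *)
  (htau : tau = \big[Num.max/tau12 2%N eta]_(2 <= j < N.+1) tau12 j eta) :
  (forall sigma : switching_signal R N,
     dwell_flee tau eta sigma -> stable A sigma) /\
  (forall sigma : switching_signal R N,
     dwell_flee' tau eta sigma -> asymptotically_stable A sigma).
Proof.
pose V (z : 'cV[R]_2) := eucl_norm (invmx (P 1%N) *m z).
pose leaf_bound j r := forall s t (z : R -> 'cV[R]_2),
  0 <= t - s <= eta -> linear_flow (A j) s t z ->
  V (z t) <= expR (alpha 1%N * tau - r * (eta - (t - s))) * V (z s).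
have leaf j : (2 <= j <= N)%N -> exists2 r, 0 < r & leaf_bound j r.
  move=> hj; have /andP[j2 jN] := hj.
  have hj1 : (1 <= j <= N)%N by rewrite jN andbT ltnW.
  have h1 : (1 <= 1 <= N)%N by rewrite /= (leq_trans _ jN)// ltnW.
  have uJ := unstable_mx_conj (hP _ hj1) (hA _ hj1) (hAj _ hj).
  have D2 : \det (mx22 (a j) (b j) (c j) (d j)) ^+ 2 = 1.
    by rewrite -hPP//; case: (hdet _ hj) => ->; rewrite ?sqrrN expr1n.
  have le_tau : alpha 1%N * tau12 j eta <= alpha 1%N * tau.
    rewrite ler_pM2l// htau; apply: (le_bigmax_seq _ j xpredT (fun i => tau12 i eta)) => //.
    by rewrite mem_index_iota j2 ltnS.
  have flowJ s t z : linear_flow (A j) s t z -> linear_flow (J j) s t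
      (fun r => mx22 (a j) (b j) (c j) (d j) *m (invmx (P 1%N) *m z r)).
    have -> : (fun r => mx22 (a j) (b j) (c j) (d j) *m (invmx (P 1%N) *m z r)) =
        (fun r => invmx (P j) *m z r).
      by apply/funext => r; rewrite -hPP// mulmxA mulmxK// hP.
    by apply: linear_flow_conj; rewrite hA// !mulmxA mulVmx ?hP// mul1mx.
  have boundI r (e : R -> R) :
      (forall s t z, s <= t -> linear_flow (A j) s t z ->
         V (z t) <= expR (e (t - s)) * V (z s)) ->
      (forall h : R, 0 <= h <= eta ->
         e h <= alpha 1%N * tau12 j eta - r * (eta - h)) ->
      leaf_bound j r.
    move=> grow slack s t z hst /grow; rewrite -subr_ge0.
    have /andP[-> _] := hst => /(_ isT) /le_trans; apply.
    rewrite ler_wpM2r ?eucl_norm_ge0// ler_expR (le_trans (slack _ hst))//.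
    by rewrite lerD2r.
  have [jk|kj] := leqP j (k + 1).
    have hjk : (2 <= j <= k + 1)%N by rewrite j2.
    have [JE _ be0] := hJcomplex _ hjk; rewrite JE in uJ flowJ.
    exists (alpha j); first exact: unstable_spiral be0 uJ.
    pose e h := alpha j * h +
      arcosh ((a j ^+ 2 + b j ^+ 2 + c j ^+ 2 + d j ^+ 2) / 2).
    apply: (boundI _ e) => [s t z st /flowJ|h _]; first exact: spiral_growth.
    by rewrite /e (tau12_complex_slack _ _ _ _ _ _ eta halpha1) htau_complex.
  have [jkl|klj] := leqP j (k + l + 1).
    have hjkl : (k + 1 < j <= k + l + 1)%N by rewrite kj.
    have [JE _] := hJdefective _ hjkl; rewrite JE in uJ flowJ.
    exists (n j); first exact: unstable_jordan uJ.
    pose e h := n j * h + arsinh ((c j ^+ 2 + d j ^+ 2) / 2 * h).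
    apply: (boundI _ e) => [s t z st /flowJ|h /andP[_ hh]]; first exact: jordan_growth.
    by rewrite htau_defective//; exact: tau12_defective_slack.
  have hjr : (k + l + 1 < j <= N)%N by rewrite klj.
  have [JE pq _] := hJreal _ hjr; rewrite JE in uJ flowJ.
  exists (q j); first exact: unstable_diag pq uJ.
  pose e h := (q j + p j) / 2 * h +
    arsinh (Num.sqrt ((a j ^+ 2 + b j ^+ 2) * (c j ^+ 2 + d j ^+ 2)) *
            sinh ((q j - p j) / 2 * h)).
  apply: (boundI _ e) => [s t z st /flowJ|h hh]; first exact: diag_growth.
  by rewrite htau_real//; exact: tau12_real_slack.
have [|r r0 leafr] := common_positive_rate _ leaf.
  move=> j r r' rr' bound s t z hst flow; apply: le_trans (bound _ _ _ hst flow) _.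
  rewrite ler_wpM2r ?eucl_norm_ge0// ler_expR lerD2l lerN2 ler_wpM2r//.
  by rewrite subr_ge0; move/andP: hst => [].
have decay (sigma : switching_signal R N) x :
    dwell_flee tau eta sigma -> solution A sigma x ->
    (forall t, 0 <= t -> V (x t) <= V (x 0)) /\
    (~ ((time_center sigma k, time_leaf sigma k) @[k --> \oo] --> (tau, eta)) ->
     V (x t) @[t --> +oo] --> (0 : R)).
  move=> dsigma xsol.
  have h1 : (1 <= 1 <= N)%N by rewrite /= -(addn0 1%N) (leq_trans _ hkl)// addn1.
  have A1 := hA _ h1; rewrite hJ1 in A1.
  apply: (star_switched_decay halpha1 r0 (hP _ h1) A1 _ dsigma xsol).
  by move=> j s t z hj hst; exact: leafr.
have [K1 K1_gt0 VK] := eucl_norm_mulmx_bounded (invmx (P 1%N)).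
have [K2 K2_gt0 KV] := eucl_norm_mulmx_bounded (P 1%N).
have xV z : eucl_norm z <= K2 * V z.
  have h1 : (1 <= 1 <= N)%N by rewrite /= (leq_trans _ hkl)// addn1.
  by rewrite -[z in leLHS](mulKVmx (hP _ h1)); exact: KV.
have stab (sigma : switching_signal R N) : dwell_flee tau eta sigma -> stable A sigma.
  move=> dsigma eps eps0; exists (eps / (K2 * K1)).
    by rewrite divr_gt0// mulr_gt0.
  move=> x xsol; rewrite ltr_pdivlMr ?mulr_gt0// => x0 t t0.
  have [/(_ t (ltW t0)) Vt _] := decay _ _ dsigma xsol.
  apply: le_lt_trans x0; apply: (le_trans (xV _)).
  by rewrite [leRHS]mulrC -mulrA ler_pM2l//; exact: le_trans Vt (VK _).
split=> // sigma [dsigma ncvg]; split; first exact: stab.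
move=> x xsol; have [_ /(_ ncvg) Vcvg] := decay _ _ dsigma xsol.
apply: (@squeeze_cvgr _ _ _ _ (fun=> 0) (fun t => K2 * V (x t))).
- by apply: nearW => t; rewrite eucl_norm_ge0 xV.
- exact: cvg_cst.
- by rewrite -(mulr0 K2); exact: cvgMr.
Qed.
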